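(* There exists a randomized weak-probe local computation algorithm for weak $2$-coloring that uses $\Theta\!\left(\frac{\log^2 n}{\log\log n}\right)$ probes, and a randomized strong-probe local computation algorithm for weak $2$-coloring that uses $\Theta\!\left(\frac{\log n}{\log\log n}\right)$ probes, where $n$ is the number of vertices of the input graph.
   Context: The input is a simple undirected graph $G=(V,E)$ with $n$ vertices with distinct IDs. A strong probe specifies a vertex $v$ and returns the list of all its neighbors; a weak probe specifies a pair $(v,j)$ and returns the degree of $v$ (if $j=0$) or the ID of the neighbor at $v$'s $j$-th port. A randomized local computation algorithm reads a random seed (fixed before the input) and, given a query vertex, makes probes and outputs that vertex's color; for every seed, the answers to all queries must form a single valid solution. The probe bounds are meant to hold with high probability over the random seed (every query is answered within the stated number of probes), and are tight up to constants for the algorithm on some graphs. A weak $2$-coloring is a map $col:V\to\{0,1\}$ such that every non-isolated vertex has a neighbor of a different color. *)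

(* Defs.v *)
From mathcomp Require Import all_boot all_order all_algebra.
From mathcomp Require Import reals exp.
Set Implicit Arguments.
Unset Strict Implicit.
Unset Printing Implicit Defensive.
Import Order.TTheory GRing.Theory Num.Theory.
Local Open Scope ring_scope.

(* A simple graph on n vertices whose IDs are distinct numbers below N.
   [ports v] lists the neighbors of v in the order of v's ports, and this
   order is arbitrary. *)
Record idgraph (n N : nat) := IdGraph {
  edge : rel 'I_n;
  edge_sym : symmetric edge;
  edge_irr : irreflexive edge;
  vid : 'I_n -> nat;
  vid_inj : injective vid;
  vid_lt : forall v, (vid v < N)%N;
  ports : 'I_n -> seq 'I_n;
  portsP : forall v, perm_eq (ports v) (enum (edge v))
}.

Definition weak_2coloring n N (G : idgraph n N) (col : 'I_n -> bool) : Prop :=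
  forall v, (exists u, edge G v u) -> exists2 u, edge G v u & col u != col v.

Definition vertex_of_id n N (G : idgraph n N) (x : nat) : option 'I_n :=
  [pick v | vid G v == x].

Record probe_model := ProbeModel {
  probe : Type;
  answer : Type;
  oracle : forall n N, idgraph n N -> probe -> answer
}.

(* Vertices are addressed by ID. The answer is [None] when no vertex has the
   given ID. *)
Definition strong_answer n N (G : idgraph n N) (x : nat) : option (seq nat) :=
  omap (fun v => map (vid G) (ports G v)) (vertex_of_id G x).

Definition strong_model : probe_model := ProbeModel strong_answer.

(* Ports are numbered from 1. The answer is [None] when the ID or the port does
   not exist. *)
Definition weak_answer n N (G : idgraph n N) (q : nat * nat) : option nat :=
  obind (fun v => if q.2 is j.+1 then omap (vid G) (onth (ports G v) j)
                  else Some #|edge G v|)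
        (vertex_of_id G q.1).

Definition weak_model : probe_model := ProbeModel weak_answer.

(* An adaptive sequence of probes ending with a color. *)
Inductive probing (M : probe_model) : Type :=
| Output of bool
| Probe of probe M & (answer M -> probing M).

Fixpoint outcome M (orc : probe M -> answer M) (t : probing M) : bool :=
  match t with
  | Output b => b
  | Probe q k => outcome orc (k (orc q))
  end.

Fixpoint nprobes M (orc : probe M -> answer M) (t : probing M) : nat :=
  match t with
  | Output _ => 0%N
  | Probe q k => (nprobes orc (k (orc q))).+1
  end.

(* The algorithm knows n and the size N of the ID space. Its seed is a string
   of [seed_len n N] fair random bits, so that the distribution of the seed does
   not depend on the graph. The last argument of [run] is the ID of the queried
   vertex. Each query is answered from the seed alone, with no memory of the
   other queries. *)
Record lca (M : probe_model) := LCA {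
  seed_len : nat -> nat -> nat;
  run : forall n N, (seed_len n N).-tuple bool -> nat -> probing M
}.

Definition lca_color M (A : lca M) n N (G : idgraph n N)
    (s : (seed_len A n N).-tuple bool) (v : 'I_n) : bool :=
  outcome (@oracle M n N G) (run s (vid G v)).

Definition lca_cost M (A : lca M) n N (G : idgraph n N)
    (s : (seed_len A n N).-tuple bool) (v : 'I_n) : nat :=
  nprobes (@oracle M n N G) (run s (vid G v)).

Definition lca_for_weak_2coloring M (A : lca M) : Prop :=
  forall n N (G : idgraph n N) (s : (seed_len A n N).-tuple bool),
    weak_2coloring G (lca_color G s).

Definition prob (R : realType) r (E : pred (r.-tuple bool)) : R :=
  #|E|%:R / 2 ^+ r.

(* "With high probability" is probability at least 1 - n ^- k for every k, with
   constants that depend on k. The first half bounds all queries on every graph.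
   The second half is the tightness of the bound: for each large n (and every
   size of the ID space) there is a graph on which some query is that costly. *)
Definition uses_Theta_probes (R : realType) M (A : lca M) (f : nat -> R) : Prop :=
  forall k : nat, exists c C : R, exists n0 : nat,
  [/\ 0 < c, 0 < C
    & forall n N : nat, (n0 <= n)%N -> (n <= N)%N ->
      (forall G : idgraph n N,
         1 - n%:R ^- k <=
           prob R [pred s | [forall v, (lca_cost (A := A) G s v)%:R <= C * f n]])
      /\
      (exists G : idgraph n N,
         1 - n%:R ^- k <=
           prob R [pred s | [exists v, c * f n <= (lca_cost (A := A) G s v)%:R]])].

(* Main.v *)
(** Every ID gets a random bit and a random label of about log log n bits, and
    labels are ordered with ties broken by ID. A vertex with a neighbor of the
    other bit keeps its bit; this relation is symmetric, so such vertices satisfy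
    each other. Any other vertex v looks at its least neighbor t v and takes the
    color opposite to that of t v. Since t (t v) is at most v, the chain v, t v,
    t (t v), ... decreases along each parity until it enters a 2-cycle, which is
    properly colored: the coloring is valid for every seed.

    A chain is explored only while all vertices seen have the same bit, so with
    high probability it sees O(log n) vertices. A chain that sees at most T
    vertices is encoded by 2T bits. If b is the number of bits of a label, the
    labels of m+1 fixed vertices are monotone with probability at most
    2^(m+1+2^b) / 2^(b(m+1)); this applies to the even places of a chain of 2m
    steps, and 2^b <= log n. A union bound over the encodings therefore gives
    m = O(log n / log log n). Each vertex of the chain is explored by one strong
    probe, or by O(log n) weak ones.

    The algorithms start with about f n dummy probes, so the lower half of the
    Theta bound holds on every graph. *)

Require Import Defs.
From mathcomp Require Import all_boot all_order all_algebra.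
From mathcomp Require Import reals exp.
From mathcomp Require Import zify ring lra.
Set Implicit Arguments.
Unset Strict Implicit.
Unset Printing Implicit Defensive.
Import Order.TTheory GRing.Theory Num.Theory.
Local Open Scope nat_scope.

(** * The coloring and its probes *)

Fixpoint argmin_from (T : Type) (key : T -> nat) (x : T) (s : seq T) : T :=
  if s is y :: s' then argmin_from key (if key y < key x then y else x) s'
  else x.

Definition argmin (T : Type) (key : T -> nat) (d : T) (s : seq T) : T :=
  if s is x :: s' then argmin_from key x s' else d.

(** Probes reveal only IDs; this turns minima over IDs into minima over vertices. *)
Lemma argmin_map (T U : Type) (g : T -> U) (key : U -> nat) d s :
  argmin key (g d) (map g s) = g (argmin (key \o g) d s).
Proof.
case: s => //= x s; elim: s x => //= y s IHs x.
by rewrite -IHs; case: ifP.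
Qed.

Lemma argmin_from_mem (T : eqType) (key : T -> nat) x s :
  argmin_from key x s \in x :: s.
Proof.
elim: s x => [|y s IHs] x /=; first exact: mem_head.
by have := IHs (if key y < key x then y else x); case: ifP => _;
  rewrite !inE => /orP[->|->]; rewrite ?orbT.
Qed.

Lemma argmin_from_le (T : eqType) (key : T -> nat) x s :
  {in x :: s, forall z, key (argmin_from key x s) <= key z}.
Proof.
elim: s x => [|y s IHs] x z /=; first by rewrite inE => /eqP->.
have le_w w : w = (if key y < key x then y else x) ->
    key (argmin_from key w s) <= key w by move=> _; apply: IHs; exact: mem_head.
have := le_w _ erefl; rewrite !inE => le1 /or3P[/eqP->|/eqP->|zs].
- by apply: leq_trans le1 _; case: ifP => //; lia.
- by apply: leq_trans le1 _; case: ifP => //; lia.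
- by apply: IHs; rewrite inE zs orbT.
Qed.

Lemma argmin_mem (T : eqType) (key : T -> nat) d s :
  s != [::] -> argmin key d s \in s.
Proof. by case: s => //= x s _; exact: argmin_from_mem. Qed.

Lemma argmin_le (T : eqType) (key : T -> nat) d s :
  {in s, forall z, key (argmin key d s) <= key z}.
Proof. by case: s => //= x s; exact: argmin_from_le. Qed.

Section Ports.
Variables (n N : nat) (G : idgraph n N).

Lemma mem_ports v u : (u \in ports G v) = edge G v u.
Proof. by rewrite (perm_mem (portsP G v)) mem_enum. Qed.

Lemma ports_uniq v : uniq (ports G v).
Proof. by rewrite (perm_uniq (portsP G v)) enum_uniq. Qed.

Lemma size_ports v : size (ports G v) = #|edge G v|.
Proof. by rewrite (perm_size (portsP G v)) cardE. Qed.

Lemma vertex_of_vid v : vertex_of_id G (vid G v) = Some v.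
Proof.
rewrite /vertex_of_id; case: pickP => [u /eqP /vid_inj -> //|/(_ v)].
by rewrite eqxx.
Qed.

End Ports.

Section Coloring.
Variables (n N : nat) (G : idgraph n N) (h : nat -> bool) (key : nat -> nat).
Implicit Types (u v : 'I_n).

Local Notation hv v := (h (vid G v)).
Local Notation kv v := (key (vid G v)).

Definition bichromatic v := has (fun u => hv u != hv v) (ports G v).

Definition target v := argmin (key \o vid G) v (ports G v).

(** The chain is not followed structurally, hence the fuel. In a 2-cycle each end compares its own
    key with that of the other, so the two ends answer differently. *)
Fixpoint chain_color fuel v :=
  if fuel is k.+1 then
    let u := target v in
    if bichromatic u then ~~ hv u
    else if target u == v then kv v < kv u else ~~ chain_color k u
  else false.

Definition chain_coloring fuel v :=
  if bichromatic v then hv v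
  else if nilp (ports G v) then false else chain_color fuel v.

Hypothesis key_inj : injective (fun v => kv v).

Lemma target_ports v : ~~ nilp (ports G v) -> target v \in ports G v.
Proof. by move=> nz; apply: argmin_mem; case: (ports G v) nz. Qed.

Lemma target_edge v : ~~ nilp (ports G v) -> edge G v (target v).
Proof. by move/target_ports; rewrite mem_ports. Qed.

Lemma edge_nilp v u : edge G v u -> ~~ nilp (ports G v).
Proof. by rewrite -mem_ports; case: (ports G v). Qed.

Lemma target_nilp v : ~~ nilp (ports G v) -> ~~ nilp (ports G (target v)).
Proof. by move/target_edge; rewrite edge_sym => /edge_nilp. Qed.

Lemma target_le v u : edge G v u -> kv (target v) <= kv u.
Proof.
by rewrite -mem_ports => uv; exact: (@argmin_le _ (key \o vid G) v _ u uv).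
Qed.

(** [v] is itself a neighbor of [target v], so minimality gives [<=]; injectivity of the keys makes
    it strict. *)
Lemma target2_lt v : ~~ nilp (ports G v) -> target (target v) != v ->
  kv (target (target v)) < kv v.
Proof.
move=> nz ne; have := target_edge nz; rewrite edge_sym => /target_le.
by rewrite leq_eqVlt => /orP[/eqP/key_inj/eqP|//]; rewrite (negbTE ne).
Qed.

(** The potential [kv v + kv (target v)] drops at every step, so fuel above it never runs out. A
    vertex and its target evaluate the same chain with fuels differing by one, which this
    reconciles. *)
Lemma chain_color_stable k k' v : ~~ nilp (ports G v) ->
  kv v + kv (target v) < k -> kv v + kv (target v) < k' ->
  chain_color k v = chain_color k' v.
Proof.
elim: k k' v => [|k IHk] [|k'] v //= nz lt1 lt2.
case: ifP => // _; case: eqP => // /eqP ne; congr (~~ _).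
have lt_t := target2_lt nz ne.
by apply: IHk; rewrite ?target_nilp //; lia.
Qed.

Lemma chain_color_alternates k v : ~~ nilp (ports G v) ->
  kv v + kv (target v) < k -> ~~ bichromatic v -> ~~ bichromatic (target v) ->
  chain_color k (target v) != chain_color k v.
Proof.
case: k => // k nz lt_k /negbTE Nbv /negbTE Nbu.
have [eq_v|ne] := eqVneq (target (target v)) v.
  rewrite /= eq_v Nbv Nbu !eqxx.
  have /eqP/= : target v <> v.
    by move=> eq_t; have := target_edge nz; rewrite eq_t edge_irr.
  by rewrite -(inj_eq key_inj) /=; lia.
rewrite [chain_color k.+1 v]/= Nbu (negbTE ne).
have lt_t := target2_lt nz ne.
by rewrite (@chain_color_stable k k.+1) ?target_nilp //; lia.
Qed.

Lemma bichromatic_sym v u : edge G v u -> hv u != hv v -> bichromatic u.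
Proof.
move=> vu ne; apply/hasP; exists v; last by rewrite eq_sym.
by rewrite mem_ports edge_sym.
Qed.

Lemma chain_coloringP fuel :
  (forall v, kv v + kv (target v) < fuel) ->
  weak_2coloring G (chain_coloring fuel).
Proof.
move=> lt_fuel v [w vw]; have nz := edge_nilp vw.
rewrite /chain_coloring; case: (boolP (bichromatic v)) => [bv|Nbv].
  have /hasP[u] := bv; rewrite mem_ports => vu ne; exists u => //.
  by rewrite (bichromatic_sym vu ne).
exists (target v); first exact: target_edge.
rewrite (negbTE nz) (negbTE (target_nilp nz)).
case: ifP => bu; last by apply: chain_color_alternates => //; rewrite bu.
(* The fuel is positive, so one unfolding shows that [v] negates the bit kept by its target. *)
have := lt_fuel v; case: fuel {lt_fuel} => //= fuel _; rewrite bu.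
by case: (h _).
Qed.

(** The chain from [v] meets no stopping condition in its first [q] steps; the neighbors of [v]
    itself are not tested. *)
Fixpoint continues q v :=
  if q is q'.+1 then
    [&& ~~ bichromatic (target v), target (target v) != v
      & continues q' (target v)]
  else true.

End Coloring.

(** * Exploration of a chain by probes *)

Section Follow.
Variables (M : probe_model) (h : nat -> bool) (key : nat -> nat).
(* [scan x k] hands to [k] the list of the neighbors of x, or [None] if one of
   them has another bit than x. *)
Variable scan : nat -> (option (seq nat) -> probing M) -> probing M.

(** A probing can only end with an output, so pending negations are accumulated in [neg]. Passing on
    the neighbors [ns] of [x] avoids a second scan of [x]. *)
Fixpoint follow fuel neg x ns : probing M :=
  if fuel is k.+1 then
    let y := argmin key x ns in
    scan y (fun a =>
      if a is Some ns' then
        if argmin key y ns' == x then Output M (neg (+) (key x < key y))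
        else follow k (~~ neg) y ns'
      else Output M (neg (+) ~~ h y))
  else Output M neg.

Definition query fuel x : probing M :=
  scan x (fun a =>
    if a is Some ns then
      if nilp ns then Output M false else follow fuel false x ns
    else Output M (h x)).

Variables (n N : nat) (G : idgraph n N).

Definition neighbor_view v : option (seq nat) :=
  if bichromatic G h v then None else Some (map (vid G) (ports G v)).

Hypothesis scan_outcome : forall v k,
  outcome (@oracle M n N G) (scan (vid G v) k) =
  outcome (@oracle M n N G) (k (neighbor_view v)).

Lemma follow_outcome fuel neg v :
  outcome (@oracle M n N G) (follow fuel neg (vid G v) (map (vid G) (ports G v)))
  = neg (+) chain_color G h key fuel v.
Proof.
elim: fuel neg v => [|fuel IHf] neg v /=; first by rewrite addbF.
rewrite argmin_map -/(target G key v) scan_outcome /neighbor_view.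
case: ifP => //= _; rewrite argmin_map -/(target G key _).
rewrite (inj_eq (vid_inj (i:=G))); case: ifP => // _.
by rewrite IHf addNb addbN.
Qed.

Lemma query_outcome fuel v :
  outcome (@oracle M n N G) (query fuel (vid G v)) =
  chain_coloring G h key fuel v.
Proof.
rewrite /query scan_outcome /neighbor_view /chain_coloring; case: ifP => //= _.
by rewrite /nilp size_map; case: ifP => //= _; rewrite follow_outcome.
Qed.

Variable w : nat.
Hypothesis scan_cost : forall v k,
  nprobes (@oracle M n N G) (scan (vid G v) k) <=
  w + nprobes (@oracle M n N G) (k (neighbor_view v)).

(** Each step costs one scan, and the exploration tests exactly the stopping conditions of
    [continues]. The bound is independent of the fuel. *)
Lemma follow_cost fuel neg q v : ~~ continues G h key q v ->
  nprobes (@oracle M n N G)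
    (follow fuel neg (vid G v) (map (vid G) (ports G v))) <= q * w.
Proof.
elim: q fuel neg v => [|q IHq] [|fuel] neg v //= Nc.
rewrite argmin_map -/(target G key v); apply: leq_trans (scan_cost _ _) _.
rewrite mulSn leq_add2l /neighbor_view; case: ifP Nc => //= _.
rewrite argmin_map -/(target G key _) (inj_eq (vid_inj (i:=G))).
by case: eqP => //= _; exact: IHq.
Qed.

(** The additional scan is that of the queried vertex; it settles the query unless the vertex has
    neighbors, all with its own bit. *)
Lemma query_cost fuel q v :
  (~~ nilp (ports G v) -> ~~ bichromatic G h v -> ~~ continues G h key q v) ->
  nprobes (@oracle M n N G) (query fuel (vid G v)) <= q.+1 * w.
Proof.
move=> Nc; apply: leq_trans (scan_cost _ _) _; rewrite mulSn leq_add2l.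
move: Nc; rewrite /neighbor_view; case: ifP => //= _ Nc.
move: Nc; rewrite /nilp size_map; case: ifP => //= _ /(_ isT isT).
exact: follow_cost.
Qed.

End Follow.

Definition pad (M : probe_model) k (q : probe M) (t : probing M) : probing M :=
  iter k (fun t' => Probe q (fun=> t')) t.

Lemma pad_outcome M orc k q t : outcome orc (@pad M k q t) = outcome orc t.
Proof. by elim: k. Qed.

Lemma pad_nprobes M orc k q t :
  nprobes orc (@pad M k q t) = k + nprobes orc t.
Proof. by elim: k => //= k ->. Qed.

Section StrongScan.
Variable h : nat -> bool.

Definition strong_scan x (k : option (seq nat) -> probing strong_model) :
    probing strong_model :=
  @Probe strong_model x (fun a =>
    let ns := odflt [::] a in
    k (if has (fun y => h y != h x) ns then None else Some ns)).

Variables (n N : nat) (G : idgraph n N).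

Lemma strong_scan_outcome v k :
  outcome (@oracle strong_model n N G) (strong_scan (vid G v) k) =
  outcome (@oracle strong_model n N G) (k (neighbor_view h G v)).
Proof.
by rewrite /= /strong_answer vertex_of_vid /= has_map.
Qed.

Lemma strong_scan_cost v k :
  nprobes (@oracle strong_model n N G) (strong_scan (vid G v) k) <=
  1 + nprobes (@oracle strong_model n N G) (k (neighbor_view h G v)).
Proof. by rewrite /= /strong_answer vertex_of_vid /= has_map. Qed.

End StrongScan.

Section WeakScan.
Variable h : nat -> bool.

(** Stopping at the first neighbor with the other bit keeps vertices of large degree cheap. [acc]
    collects the neighbors in port order. *)
Fixpoint port_scan x j d acc (k : option (seq nat) -> probing weak_model) :
    probing weak_model :=
  if d is d'.+1 then
    @Probe weak_model (x, j.+1) (fun a =>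
      let y := odflt 0 a in
      if h y != h x then k None else port_scan x j.+1 d' (rcons acc y) k)
  else k (Some acc).

Definition weak_scan x k : probing weak_model :=
  @Probe weak_model (x, 0) (fun a => port_scan x 0 (odflt 0 a) [::] k).

Variables (n N : nat) (G : idgraph n N).
Local Notation orc := (@oracle weak_model n N G).

Lemma weak_degree_answer v : orc (vid G v, 0) = Some (size (ports G v)).
Proof. by rewrite /= /weak_answer vertex_of_vid /= size_ports. Qed.

Lemma weak_port_answer v s1 u s2 : ports G v = s1 ++ u :: s2 ->
  orc (vid G v, (size s1).+1) = Some (vid G u).
Proof.
move=> eq_p; rewrite /= /weak_answer vertex_of_vid /= eq_p.
by rewrite onth_cat ltnn subnn.
Qed.

Lemma port_scan_outcome v s1 s2 k : ports G v = s1 ++ s2 ->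
  outcome orc (port_scan (vid G v) (size s1) (size s2) (map (vid G) s1) k) =
  outcome orc (k (if has (fun u => h (vid G u) != h (vid G v)) s2 then None
                  else Some (map (vid G) (ports G v)))).
Proof.
elim: s2 s1 => [|u s2 IHs] s1 eq_p /=; first by rewrite eq_p cats0.
have /= -> := weak_port_answer eq_p; rewrite /=; case: ifP => //= _.
rewrite -map_rcons -(size_rcons s1 u) IHs //.
by rewrite cat_rcons.
Qed.

Lemma weak_scan_outcome v k :
  outcome orc (weak_scan (vid G v) k) = outcome orc (k (neighbor_view h G v)).
Proof.
have /= E := weak_degree_answer v; rewrite /= E /=.
exact: (@port_scan_outcome v [::] (ports G v)).
Qed.

(** Either fewer than [t] ports remain, or one of the next [t] leads to the other bit and ends the
    scan. *)
Lemma port_scan_cost v s1 s2 k t : ports G v = s1 ++ s2 ->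
  ~~ ((t <= size s2) && all (fun u => h (vid G u) == h (vid G v)) (take t s2)) ->
  nprobes orc (port_scan (vid G v) (size s1) (size s2) (map (vid G) s1) k) <=
  t + nprobes orc
    (k (if has (fun u => h (vid G u) != h (vid G v)) s2 then None
        else Some (map (vid G) (ports G v)))).
Proof.
elim: s2 s1 t => [|u s2 IHs] s1 [|t] eq_p //=.
  by rewrite eq_p cats0 leq_addl.
have /= -> := weak_port_answer eq_p; rewrite /= ltnS; case: eqP => //= _ Ns.
  rewrite addSn ltnS -map_rcons -(size_rcons s1 u) IHs //.
  by rewrite cat_rcons.
by rewrite addSn ltnS leq_addl.
Qed.

Lemma weak_scan_cost t v k :
  ~~ ((t <= size (ports G v)) &&
      all (fun u => h (vid G u) == h (vid G v)) (take t (ports G v))) ->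
  nprobes orc (weak_scan (vid G v) k) <=
  t.+1 + nprobes orc (k (neighbor_view h G v)).
Proof.
have /= E := weak_degree_answer v; rewrite /= E /= addSn ltnS.
exact: (@port_scan_cost v [::] (ports G v)).
Qed.

End WeakScan.

(** * Encoding of chains *)

Section Walk.
Variables (n N : nat) (G : idgraph n N) (h : nat -> bool) (key : nat -> nat).
Hypothesis key_inj : injective (fun v => key (vid G v)).
Implicit Types (u v : 'I_n).

Local Notation kv v := (key (vid G v)).
Local Notation tgt := (target G key).

(* The bits decide, candidate after candidate, whether to move there. A and B
   are the vertices already offered at the steps of the same and of the other
   parity, and no vertex is offered twice at the same parity. *)
Fixpoint walk (s : seq bool) (c A B : seq 'I_n) : seq 'I_n :=
  match s, c with
  | b :: s', u :: c' =>
      if b then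
        let c1 := [seq x <- ports G u | x \notin B] in
        u :: walk s' c1 (c1 ++ B) A
      else walk s' c' A B
  | _, _ => [::]
  end.

(** Trailing [false] bits only refuse candidates. Codes can thus be padded to a common length, and
    the union bound runs over tuples. *)
Lemma walk_pad s k c A B : walk (s ++ nseq k false) c A B = walk s c A B.
Proof.
elim: s c A B => [|b s IHs] [|u c] A B //=; last by case: b; rewrite IHs.
  by case: k.
by elim: k u c => //= k IHk u [|u' c]; [case: (k) | exact: IHk].
Qed.

Lemma walk_take c1 u c2 s A B :
  walk (nseq (size c1) false ++ true :: s) (c1 ++ u :: c2) A B =
  u :: walk s [seq x <- ports G u | x \notin B]
            ([seq x <- ports G u | x \notin B] ++ B) A.
Proof. by elim: c1 => //= x c1 ->. Qed.

Lemma iter_target_nilp i v : ~~ nilp (ports G v) ->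
  ~~ nilp (ports G (iter i tgt v)).
Proof. by move=> nz; elim: i => //= i; exact: target_nilp. Qed.

(* Keys decrease along each parity, so the next vertex of a chain has not been
   offered at its parity; hence two bits per vertex of [D] encode the chain. *)
Lemma walk_code p v (A B D : seq 'I_n) :
  ~~ nilp (ports G v) -> continues G h key p v -> uniq A -> uniq B ->
  {subset A <= D} -> {subset B <= D} ->
  (forall i, i < p -> {subset ports G (iter i tgt v) <= D}) ->
  {in A, forall z, kv (tgt v) < kv z} -> {in B, forall z, kv v <= kv z} ->
  exists2 s, size s + size A + size B <= (size D).*2 &
    walk s [seq x <- ports G v | x \notin A]
         ([seq x <- ports G v | x \notin A] ++ A) B = traject tgt (tgt v) p.
Proof.
elim: p v A B => [|p IHp] v A B nz.
  move=> _ uA uB AD BD _ _ _; exists [::] => //.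
  (* Both lists are duplicate-free inside [D]; this is the source of the factor two. *)
  by rewrite -addnn leq_add // uniq_leq_size.
move=> /= /and3P[_ ne ct] uA uB AD BD PD keyA keyB.
set c := [seq _ <- _ | _].
have c_t : tgt v \in c.
  rewrite mem_filter target_ports // andbT; apply/negP => /keyA.
  by rewrite ltnn.
have [s le_s eq_w] : exists2 s, size s + size B + size (c ++ A) <= (size D).*2 &
    walk s [seq x <- ports G (tgt v) | x \notin B]
      ([seq x <- ports G (tgt v) | x \notin B] ++ B) (c ++ A)
    = traject tgt (tgt (tgt v)) p.
  (* The parity changes, so the two lists exchange roles, and the new candidates [c] join [A]. *)
  apply: IHp => //; first exact: target_nilp.
  - rewrite cat_uniq filter_uniq ?ports_uniq // uA andbT /=.
    by apply/hasPn => z zA; rewrite mem_filter zA.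
  - move=> z; rewrite mem_cat mem_filter => /orP[/andP[_ zv]|/AD//].
    exact: (PD 0).
  - by move=> i lt_i z zv; apply: (PD i.+1) => //; rewrite iterSr.
  - by move=> z /keyB; apply: leq_trans; exact: target2_lt.
  - move=> z; rewrite mem_cat mem_filter => /orP[/andP[_]|/keyA/ltnW//].
    by rewrite mem_ports; exact: target_le.
case: (splitPr c_t) le_s eq_w => c1 c2 le_s eq_w.
(* Refuse the candidates before [tgt v], accept [tgt v], then continue with the code of the rest. *)
exists (nseq (size c1) false ++ true :: s); last by rewrite walk_take eq_w.
by move: le_s; rewrite !size_cat size_nseq /=; lia.
Qed.

(** This depends on the graph and the code alone, not on the seed, so the labels along it can be
    counted. *)
Definition walk_from v s := v :: walk s (ports G v) (ports G v) [::].

Definition evens m v (s : seq 'I_n) := [seq nth v s i.*2 | i <- iota 0 m.+1].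

(** The chain is followed regardless of the bits, so for fixed labels this is a fixed list of
    vertices. *)
Definition discovered m v :=
  undup (flatten [seq ports G (iter i tgt v) | i <- iota 0 m.*2]).

Lemma discovered_ports m v i : i < m.*2 ->
  {subset ports G (iter i tgt v) <= discovered m v}.
Proof.
move=> lt_i z zi; rewrite mem_undup; apply/flattenP.
by exists (ports G (iter i tgt v)) => //; apply/mapP; exists i; rewrite ?mem_iota.
Qed.

Lemma chain_walk m v : ~~ nilp (ports G v) -> continues G h key m.*2 v ->
  exists2 s, size s <= (size (discovered m v)).*2 &
    walk_from v s = traject tgt v m.*2.+1.
Proof.
move=> nz ct.
have [s] := @walk_code m.*2 v [::] [::] (discovered m v) nz ct isT isT
   (fun z => ltac:(by [])) (fun z => ltac:(by [])) (@discovered_ports m v)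
   (fun z => ltac:(by [])) (fun z => ltac:(by [])).
rewrite /= !addn0 cats0 filter_predT => le_s eq_s; exists s => //.
by rewrite /walk_from eq_s.
Qed.

Lemma continues_iter q v i : continues G h key q v -> i < q ->
  (~~ bichromatic G h (iter i.+1 tgt v)) &&
  (tgt (tgt (iter i tgt v)) != iter i tgt v).
Proof.
elim: q v i => // q IHq v [|i] /= /and3P[Nb ne ct] lt_i; first by rewrite Nb.
have := IHq _ _ ct lt_i; rewrite -!iterSr; exact.
Qed.

Lemma evens_traject m v :
  evens m v (traject tgt v m.*2.+1) = [seq iter i.*2 tgt v | i <- iota 0 m.+1].
Proof.
apply/eq_in_map => i; rewrite mem_iota => /andP[_ lt_i].
by rewrite nth_traject //; lia.
Qed.

(** Every second step lowers the key by [target2_lt]; the reversal makes the order increasing. *)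
Lemma evens_sorted m v : ~~ nilp (ports G v) -> continues G h key m.*2 v ->
  sorted (fun x y => kv x < kv y) (rev (evens m v (traject tgt v m.*2.+1))).
Proof.
move=> nz ct; rewrite evens_traject rev_sorted sorted_map.
apply/(sortedP 0) => i; rewrite size_iota => lt_i.
rewrite !nth_iota /= ?add0n; try lia.
have /andP[_] := continues_iter ct (ltac:(lia) : i.*2 < m.*2).
by apply: target2_lt => //; exact: iter_target_nilp.
Qed.

Lemma continues_monochromatic m v : ~~ bichromatic G h v ->
  continues G h key m.*2 v ->
  {in discovered m v, forall u, h (vid G u) = h (vid G v)}.
Proof.
move=> Nb ct.
have Nbi i : i < m.*2 -> ~~ bichromatic G h (iter i tgt v).
  by case: i => // i lt_i; have /andP[] := continues_iter ct (ltnW lt_i).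
have mono u w : ~~ bichromatic G h w -> u \in ports G w ->
    h (vid G u) = h (vid G w).
  by move=> /hasPn Nbw /Nbw; rewrite negbK => /eqP.
have hi i : i < m.*2 -> h (vid G (iter i tgt v)) = h (vid G v).
  elim: i => // i IHi lt_i; rewrite -IHi ?(ltnW lt_i) //.
  (* An isolated vertex is its own target, by the default of [argmin], so its chain is constant. *)
  have [nv|nv] := boolP (nilp (ports G v)).
    have tv : tgt v = v by rewrite /target; case: (ports G v) nv.
    have it j : iter j tgt v = v by elim: j => //= j ->.
    by rewrite !it.
  by apply: mono; rewrite ?Nbi ?(ltnW lt_i) //;
     exact/target_ports/iter_target_nilp.
move=> u; rewrite mem_undup => /flattenP[_ /mapP[i + ->]].
by rewrite mem_iota => /= lt_i ui; rewrite (mono _ _ (Nbi _ lt_i) ui) hi.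
Qed.

End Walk.

(** * Counting *)

Section Counting.
Implicit Types (I X : finType).

(** Functions with prescribed values form a product: singletons over [xs], all of [X] elsewhere. The
    multiplied form avoids division. *)
Lemma card_restriction1 I X (xs : seq I) (t : (size xs).-tuple X) : uniq xs ->
  #|[pred g : {ffun I -> X} | [seq g x | x <- xs] == t]| * #|X| ^ size xs
  = #|X| ^ #|I|.
Proof.
move=> uxs; case: (posnP #|X|) => [X0|/card_gt0P[x0 _]].
  case: xs t uxs => [|x xs] t _; last first.
    by case/tupleP: t => a t; have := fintype0 a X0.
  rewrite expn0 muln1 -card_ffun; apply: eq_card => g.
  by rewrite !inE tuple0.
pose F i := [pred x : X | (i \in xs) ==> (x == nth x0 t (index i xs))].
have -> : #|[pred g : {ffun I -> X} | [seq g x | x <- xs] == t]|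
    = #|[pred g : {ffun I -> X} | g \in family F]|.
  apply: eq_card => g; rewrite !inE; apply/eqP/familyP => [eq_t i|Fg].
    rewrite inE; apply/implyP => ixs; rewrite -eq_t (nth_map i) ?index_mem //.
    by rewrite nth_index.
  apply: (@eq_from_nth _ x0); rewrite size_map ?size_tuple // => j lt_j.
  have i0 : I by case: (xs) lt_j.
  rewrite (nth_map i0) //; have := Fg (nth i0 xs j).
  by rewrite inE mem_nth // index_uniq // => /eqP.
have -> : #|[pred g : {ffun I -> X} | g \in family F]| = \prod_i #|F i|.
  by rewrite -(big_image _ _ _ _ id) -foldrE -card_family; apply: eq_card.
have -> : \prod_i #|F i| = #|X| ^ #|[predC xs]|.
  rewrite (bigID (mem xs)) /= big1 ?mul1n => [|i ixs].
    rewrite -prod_nat_const; apply: eq_bigr => i Nixs.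
    by apply: eq_card => x; rewrite !inE (negbTE Nixs).
  rewrite -(card1 (nth x0 t (index i xs))); apply: eq_card => x.
  by rewrite !inE ixs.
by rewrite -expnD -(card_uniqP uxs) addnC cardC.
Qed.

(** Sum over fibers: a uniform function restricted to distinct points is uniform. *)
Lemma card_restriction I X (xs : seq I) (Q : pred (seq X)) : uniq xs ->
  #|[pred g : {ffun I -> X} | Q [seq g x | x <- xs]]| * #|X| ^ size xs
  = #|[pred t : (size xs).-tuple X | Q t]| * #|X| ^ #|I|.
Proof.
move=> uxs; pose phi (g : {ffun I -> X}) := map_tuple g (in_tuple xs).
rewrite -sum1_card (partition_big phi [pred t | Q (tval t)]) //=.
rewrite -[X in _ = X * _]sum1_card !big_distrl /=; apply: eq_bigr => t Qt.
rewrite mul1n -(card_restriction1 t uxs) sum1_card; congr (_ * _).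
apply: eq_card => g; rewrite !inE unfold_in /= inE -val_eqE /=.
by apply: andb_idl => /eqP->.
Qed.

(** The union bound, with denominators cleared. *)
Lemma card_exists (I T : finType) (P : I -> pred T) c B :
  (forall i, #|P i| * c <= B) ->
  #|[pred w | [exists i, P i w]]| * c <= #|I| * B.
Proof.
move=> leB; apply: leq_trans (_ : (\sum_i #|P i|) * c <= _); last first.
  by rewrite big_distrl -sum_nat_const; apply: leq_sum.
rewrite leq_mul2r; apply/orP; right.
under eq_bigr do rewrite -sum1_card.
rewrite (exchange_big_dep predT) //= -sum1_card big_mkcond /=.
apply: leq_sum => w _; case: ifP => // /existsP[i Piw].
by rewrite (bigD1 i).
Qed.

(** Conditioning on the second coordinate: the event on the first may depend on it. *)
Lemma card_pair_fiber (T U : finType) (P : U -> pred T) c B :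
  (forall u, #|P u| * c <= B) ->
  #|[pred w : T * U | P w.2 w.1]| * c <= B * #|U|.
Proof.
move=> leB; have -> : #|[pred w : T * U | P w.2 w.1]| = \sum_u #|P u|.
  rewrite -sum1_card; under [RHS]eq_bigr do rewrite -sum1_card.
  by rewrite pair_big_dep /= (reindex (fun p : U * T => (p.2, p.1))) //;
    exists (fun p : T * U => (p.2, p.1)) => -[].
by rewrite big_distrl mulnC -sum_nat_const; apply: leq_sum.
Qed.

Lemma bin_le_exp2 m p : 'C(m, p) <= 2 ^ m.
Proof.
elim: m p => [|m IHm] [|p]; rewrite ?bin0 ?expn_gt0 //.
by rewrite binS expnS mul2n -addnn leq_add.
Qed.

Definition label X (x : X) : nat := enum_rank x.

Lemma label_lt X (x : X) : label x < #|X|.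
Proof. exact: ltn_ord. Qed.

(** Nondecreasing tuples are counted by a binomial coefficient ['C(p + #|X|, p)], here over a range
    widened by one value to make it nonempty. *)
Lemma card_sorted_labels X p :
  #|[pred t : p.-tuple X | sorted leq [seq label x | x <- t]]|
  <= 2 ^ (p + #|X|).
Proof.
pose f (t : p.-tuple X) : p.-tuple 'I_#|X|.+1 :=
  map_tuple (fun x => widen_ord (leqnSn _) (enum_rank x)) t.
have f_inj : injective f.
  move=> t1 t2 /(congr1 val)/= /inj_map eq_t; apply/val_inj/eq_t => x y.
  by move/(congr1 val) => /= /val_inj; exact: enum_rank_inj.
rewrite -(card_image f_inj); apply: leq_trans (bin_le_exp2 _ p).
rewrite -card_sorted_tuples; apply/subset_leq_card/subsetP => _ /imageP[t + ->].
by rewrite !inE -map_comp.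
Qed.

Lemma card_constant_tuples p : #|[pred t : p.-tuple bool | constant t]| <= 2.
Proof.
rewrite -[X in _ <= X]card_bool.
apply: leq_trans (leq_image_card (fun c : bool => nseq_tuple p c) predT).
apply/subset_leq_card/subsetP => t; rewrite inE => /(constantP false)[c eq_t].
by apply/codomP; exists c; apply/val_inj; rewrite /= {1}eq_t size_tuple.
Qed.

End Counting.

(** * Bad seeds *)

Section Seed.
Variables (N b : nat).

Definition seed_bit (s : seq bool) x j := nth false s (x * b.+1 + j).

Definition decode (s : (N * b.+1).-tuple bool) :
    {ffun 'I_N -> bool} * {ffun 'I_N -> b.-tuple bool} :=
  ([ffun x : 'I_N => seed_bit s x 0],
   [ffun x : 'I_N => [tuple seed_bit s x j.+1 | j < b]]).

Lemma decode_inj : injective decode.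
Proof.
move=> s t [/ffunP eq_h /ffunP eq_r]; apply/val_inj/(@eq_from_nth _ false).
  by rewrite !size_tuple.
move=> i; rewrite size_tuple => lt_i.
have lt_x : i %/ b.+1 < N by rewrite ltn_divLR.
have lt_j := ltn_pmod i (ltn0Sn b).
rewrite (divn_eq i b.+1); case: (i %% b.+1) lt_j => [_|j lt_j].
  by have := eq_h (Ordinal lt_x); rewrite !ffunE.
have := congr1 (fun t : b.-tuple bool => tnth t (Ordinal (lt_j : j < b)))
  (eq_r (Ordinal lt_x)).
rewrite !ffunE.
by rewrite !tnth_mktuple.
Qed.

(** Injectivity of [decode] suffices, since bad seeds are only bounded from above. *)
Lemma card_decode (P : pred ({ffun 'I_N -> bool} * {ffun 'I_N -> b.-tuple bool})) :
  #|[pred s | P (decode s)]| <= #|P|.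
Proof.
rewrite -(card_image decode_inj); apply/subset_leq_card/subsetP.
by move=> _ /imageP[s + ->]; rewrite inE.
Qed.

Definition color_bit (hf : {ffun 'I_N -> bool}) (x : nat) : bool :=
  if insub x is Some i then hf i else false.

(* The labels are compared first, and the IDs break ties. *)
Definition rank_key (rf : {ffun 'I_N -> b.-tuple bool}) (x : nat) : nat :=
  (if insub x is Some i then label (rf i) else 0) * N + x.

Variables (n : nat) (G : idgraph n N).
Implicit Types (hf : {ffun 'I_N -> bool}) (rf : {ffun 'I_N -> b.-tuple bool}).

Definition id_ord (v : 'I_n) : 'I_N := Ordinal (vid_lt G v).

Lemma id_ord_inj : injective id_ord.
Proof. by move=> u v /(congr1 val)/= /vid_inj. Qed.

Lemma color_bit_vid hf v : color_bit hf (vid G v) = hf (id_ord v).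
Proof.
rewrite /color_bit insubT ?vid_lt // => lt_v.
by congr (hf _); apply: val_inj.
Qed.

Lemma rank_key_vid rf v :
  rank_key rf (vid G v) = label (rf (id_ord v)) * N + vid G v.
Proof.
rewrite /rank_key insubT ?vid_lt // => lt_v; congr (label (rf _) * _ + _).
exact: val_inj.
Qed.

(** Recovers the label from the key, so sorted keys yield sorted labels. *)
Lemma rank_key_div rf v :
  rank_key rf (vid G v) %/ N = label (rf (id_ord v)).
Proof.
have lt_v := vid_lt G v.
by rewrite rank_key_vid divnMDl ?divn_small ?addn0 //; apply: leq_ltn_trans lt_v.
Qed.

Lemma rank_key_inj rf : injective (fun v => rank_key rf (vid G v)).
Proof.
move=> u v; rewrite !rank_key_vid => /(congr1 (modn^~ N)).
by rewrite !modnMDl !modn_small ?vid_lt // => /vid_inj.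
Qed.

Lemma rank_key_lt rf v : rank_key rf (vid G v) < 2 ^ b * N.
Proof.
rewrite rank_key_vid; have := label_lt (rf (id_ord v)).
rewrite card_tuple card_bool; have := vid_lt G v; nia.
Qed.

Definition mono_prefix T (xs : seq 'I_n) hf :=
  (T <= size xs) && constant [seq hf (id_ord u) | u <- take T xs].

(** At most two of the [2 ^ T] bit patterns on [T] distinct vertices are constant. *)
Lemma card_mono_prefix T xs : uniq xs ->
  #|[pred hf | mono_prefix T xs hf]| * 2 ^ T <= 2 * 2 ^ N.
Proof.
move=> uxs; rewrite /mono_prefix; case: (leqP T (size xs)) => [le_T|_]; last first.
  by rewrite eq_card0.
pose ys := map id_ord (take T xs).
have uys : uniq ys by rewrite map_inj_uniq ?take_uniq //; exact: id_ord_inj.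
have sys : size ys = T by rewrite size_map size_takel.
have := card_restriction (@constant bool) uys.
rewrite sys card_bool card_ord.
rewrite (@eq_card _ _ [pred hf : {ffun 'I_N -> bool} |
   constant [seq hf (id_ord u) | u <- take T xs]]).
  by move=> ->; rewrite leq_mul2r card_constant_tuples orbT.
by move=> hf; rewrite !inE -map_comp.
Qed.

(** The walk of an arbitrary code may revisit vertices; [uniq] restricts to the case where the
    labels are independent. *)
Definition sorted_labels (xs : seq 'I_n) rf :=
  uniq xs && sorted leq [seq label (rf (id_ord u)) | u <- xs].

Lemma card_sorted_labels_seed xs :
  #|[pred rf | sorted_labels xs rf]| * (2 ^ b) ^ size xs
  <= 2 ^ (size xs + 2 ^ b) * (2 ^ b) ^ N.
Proof.
rewrite /sorted_labels; case: (boolP (uniq xs)) => [uxs|_]; last first.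
  by rewrite eq_card0.
pose ys := map id_ord xs.
have uys : uniq ys by rewrite map_inj_uniq //; exact: id_ord_inj.
have sys : size ys = size xs by rewrite size_map.
have := card_restriction
  (fun s : seq (b.-tuple bool) => sorted leq [seq label x | x <- s]) uys.
rewrite sys card_ord card_tuple card_bool.
rewrite (@eq_card _ _ [pred rf : {ffun 'I_N -> b.-tuple bool} | sorted leq
   [seq label (rf (id_ord u)) | u <- xs]]).
  move=> ->; rewrite leq_mul2r; apply/orP; right.
  have := card_sorted_labels (b.-tuple bool) (size xs).
  by rewrite card_tuple card_bool.
by move=> rf; rewrite !inE -!map_comp.
Qed.

Variables (T m : nat).

(** The first event makes a weak scan long, the second lets a chain see many vertices, the third
    lets a chain with a short code be long. The first two are counted over the bits, the third over
    the labels. *)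
Definition bad (w : {ffun 'I_N -> bool} * {ffun 'I_N -> b.-tuple bool}) :=
  [|| [exists v, mono_prefix T (ports G v) w.1],
      [exists v, mono_prefix T (discovered G (rank_key w.2) m v) w.1]
    | [exists p : 'I_n * T.*2.-tuple bool,
         sorted_labels (rev (evens m p.1 (walk_from G p.1 p.2))) w.2]].

(** Each of the three events holds for at most a fraction [1 / (4 n^k)] of the pairs: the first two
    by [leT], the third by [lem]. *)
Lemma card_bad k : 0 < n -> 8 * n ^ k.+1 <= 2 ^ T ->
  4 * n ^ k.+1 * 2 ^ T.*2 * 2 ^ (m.+1 + 2 ^ b) <= (2 ^ b) ^ m.+1 ->
  #|bad| * n ^ k <= 2 ^ (N * b.+1).
Proof.
move=> n0 leT lem.
have -> : 2 ^ (N * b.+1) = 2 ^ N * (2 ^ b) ^ N.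
  by rewrite -expnM -expnD mulnS [b * N]mulnC.
set HW := 2 ^ N * _.
pose W := ({ffun 'I_N -> bool} * {ffun 'I_N -> b.-tuple bool})%type.
pose P0 := [pred w : W | [exists v, mono_prefix T (ports G v) w.1]].
pose P1 := [pred w : W |
  [exists v, mono_prefix T (discovered G (rank_key w.2) m v) w.1]].
pose P2 := [pred w : W | [exists p : 'I_n * T.*2.-tuple bool,
         sorted_labels (rev (evens m p.1 (walk_from G p.1 p.2))) w.2]].
have cH : #|{ffun 'I_N -> bool}| = 2 ^ N by rewrite card_ffun card_bool card_ord.
have cR : #|{ffun 'I_N -> b.-tuple bool}| = (2 ^ b) ^ N.
  by rewrite card_ffun card_tuple card_bool card_ord.
have le_bad : #|bad| <= #|P0| + #|P1| + #|P2|.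
  apply: leq_trans (_ : #|[predU [predU P0 & P1] & P2]| <= _).
    by apply/subset_leq_card/subsetP => w; rewrite !inE unfold_in /bad orbA.
  apply: leq_trans (_ : #|[predU P0 & P1]| + #|P2| <= _).
    by rewrite -cardUI leq_addr.
  by rewrite leq_add2r -cardUI leq_addr.
have le0 : #|P0| * 2 ^ T <= n * (2 * HW).
  rewrite -[X in _ <= X * _]card_ord; apply: card_exists => v.
  rewrite mulnA -cR; apply: (@card_pair_fiber _ _
     (fun _ hf => mono_prefix T (ports G v) hf)).
  by move=> _; apply: card_mono_prefix; exact: ports_uniq.
have le1 : #|P1| * 2 ^ T <= n * (2 * HW).
  rewrite -[X in _ <= X * _]card_ord; apply: card_exists => v.
  (* With the labels fixed, the discovered vertices are fixed and only the bits vary. *)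
  rewrite mulnA -cR; apply: (@card_pair_fiber _ _
     (fun rf hf => mono_prefix T (discovered G (rank_key rf) m v) hf)).
  by move=> rf; apply: card_mono_prefix; exact: undup_uniq.
have le2 : #|P2| * (2 ^ b) ^ m.+1 <= n * 2 ^ T.*2 * (2 ^ (m.+1 + 2 ^ b) * HW).
  have <- : #|{: 'I_n * T.*2.-tuple bool}| = n * 2 ^ T.*2.
    by rewrite card_prod card_ord card_tuple card_bool.
  apply: card_exists => -[v s] /=.
  pose Q (hf : {ffun 'I_N -> bool}) rf :=
    sorted_labels (rev (evens m v (walk_from G v s))) rf.
  have -> : 2 ^ (m.+1 + 2 ^ b) * HW = 2 ^ (m.+1 + 2 ^ b) * (2 ^ b) ^ N * 2 ^ N.
    by rewrite /HW; lia.
  rewrite -cH.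
  (* The coordinates are swapped so that the bits become the fixed one. *)
  have -> : #|(fun w : W => sorted_labels (rev (evens m v (walk_from G v s))) w.2)|
      = #|[pred w : {ffun 'I_N -> b.-tuple bool} * {ffun 'I_N -> bool} | Q w.2 w.1]|.
    rewrite -!sum1_card (reindex (fun p : _ * _ => (p.2, p.1))) //.
    by exists (fun p : _ * _ => (p.2, p.1)) => -[].
  apply: card_pair_fiber => hf.
  have := card_sorted_labels_seed (rev (evens m v (walk_from G v s))).
  by rewrite size_rev size_map size_iota.
have cancel c d : 0 < c -> forall a e, a * e <= c * HW -> c * d <= e -> a * d <= HW.
  move=> c0 a e le_a le_e; rewrite -(leq_pmul2l c0).
  by apply: leq_trans le_a; rewrite mulnCA leq_mul2l le_e orbT.
have {}le0 : #|P0| * (4 * n ^ k) <= HW.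
  apply: (@cancel (n * 2) _ _ _ (2 ^ T)); rewrite ?muln_gt0 ?n0 -?mulnA //.
  by apply: leq_trans leT; rewrite expnS; lia.
have {}le1 : #|P1| * (4 * n ^ k) <= HW.
  apply: (@cancel (n * 2) _ _ _ (2 ^ T)); rewrite ?muln_gt0 ?n0 -?mulnA //.
  by apply: leq_trans leT; rewrite expnS; lia.
have {}le2 : #|P2| * (4 * n ^ k) <= HW.
  apply: (@cancel (n * 2 ^ T.*2 * 2 ^ (m.+1 + 2 ^ b)) _ _ _ ((2 ^ b) ^ m.+1)).
  - by rewrite !muln_gt0 n0 !expn_gt0.
  - by rewrite -mulnA.
  - by apply: leq_trans lem; rewrite expnS; lia.
have := leq_mul le_bad (leqnn (4 * n ^ k)); rewrite !mulnDl.
lia.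
Qed.

Section Good.
Variables (hf : {ffun 'I_N -> bool}) (rf : {ffun 'I_N -> b.-tuple bool}).
Hypothesis good : ~~ bad (hf, rf).
Local Notation h := (color_bit hf).
Local Notation key := (rank_key rf).

Lemma good_ports v : ~~ ((T <= size (ports G v)) &&
  all (fun u => h (vid G u) == h (vid G v)) (take T (ports G v))).
Proof.
apply: contra good => /andP[leT /allP eq_h]; apply/orP; left.
apply/existsP; exists v; rewrite /mono_prefix leT /=.
apply/(constantP false); exists (h (vid G v)); rewrite size_map.
apply: (@eq_from_nth _ false) => [|i]; rewrite size_map ?size_nseq // => lt_i.
rewrite (nth_map v) // nth_nseq lt_i -color_bit_vid.
by apply/eqP/eq_h/mem_nth.
Qed.

(** A long chain is monochromatic, so it discovers fewer than [T] vertices and has a code of at most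
    [2 T] bits. Its even places then have distinct vertices with sorted labels, which is the third
    bad event. *)
Lemma good_chain v : ~~ nilp (ports G v) -> ~~ bichromatic G h v ->
  ~~ continues G h key m.*2 v.
Proof.
move=> nz Nb; apply/negP => ct.
have mono := continues_monochromatic Nb ct.
have lt_D : size (discovered G key m v) < T.
  rewrite ltnNge; apply: contra good => leT.
  rewrite /bad /=; apply/or3P/Or32/existsP; exists v.
  rewrite /mono_prefix leT /=.
  apply/(constantP false); exists (h (vid G v)); rewrite size_map.
  apply: (@eq_from_nth _ false) => [|i]; rewrite size_map ?size_nseq // => lt_i.
  rewrite (nth_map v) // nth_nseq lt_i -color_bit_vid.
  by apply: mono; apply: mem_take (mem_nth _ lt_i).
have [s le_s eq_s] := chain_walk (@rank_key_inj rf) nz ct.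
have size_s : size (s ++ nseq (T.*2 - size s) false) == T.*2.
  by rewrite size_cat size_nseq; lia.
case/negP: good; rewrite /bad /=; apply/or3P/Or33/existsP.
exists (v, Tuple size_s); rewrite /= /walk_from walk_pad -/(walk_from G v s) eq_s.
have srt := evens_sorted (@rank_key_inj rf) nz ct.
apply/andP; split.
  apply: sorted_uniq srt => [y x z|x]; [exact: ltn_trans|exact: ltnn].
rewrite sorted_map; apply: sub_sorted srt => x y /ltnW /(leq_div2r N) /=.
by rewrite !rank_key_div.
Qed.

End Good.
End Seed.

(** * The algorithms *)

Definition label_bits n := trunc_log 2 (trunc_log 2 n).

(** The addend 3 pays for the factor 8 in [card_bad]. *)
Definition revealed_bound k n := k.+1 * (trunc_log 2 n).+1 + 3.

(** With [L = trunc_log 2 n], the code bits and [n ^ k.+1] need [(3k + 3)(L + 1)] plus a constant;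
    the remaining [9 (L + 1)] absorbs that constant and [2 ^ b <= L]. One bit per label is lost to
    the factor [2 ^ m.+1], hence the predecessor in the divisor. *)
Definition chain_bound k n :=
  (3 * k + 12) * (trunc_log 2 n).+1 %/ (label_bits n).-1.

Lemma label_bits_ge2 n : 16 <= n -> 2 <= label_bits n.
Proof.
move=> n16; apply: trunc_log_max => //; apply: trunc_log_max => //.
Qed.

Lemma revealed_boundP k n : 8 * n ^ k.+1 <= 2 ^ revealed_bound k n.
Proof.
rewrite expnD mulnC leq_mul2r /= mulnC expnM leq_exp2r //.
exact/ltnW/trunc_log_ltn.
Qed.

Lemma chain_boundP k n : 16 <= n ->
  4 * n ^ k.+1 * 2 ^ (revealed_bound k n).*2 *
    2 ^ ((chain_bound k n).+1 + 2 ^ label_bits n)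
  <= (2 ^ label_bits n) ^ (chain_bound k n).+1.
Proof.
move=> n16; set T := revealed_bound k n; set m := chain_bound k n.
set b := label_bits n; set L := trunc_log 2 n.
have b2 : 2 <= b by exact: label_bits_ge2.
have leL : 2 ^ b <= L.
  by apply: trunc_logP => //; apply: leq_trans (trunc_log_max _ (n16 : 2 ^ 4 <= n)).
have le_n : n ^ k.+1 <= 2 ^ (L.+1 * k.+1).
  by rewrite expnM leq_exp2r //; exact/ltnW/trunc_log_ltn.
apply: leq_trans (_ : 2 ^ 2 * 2 ^ (L.+1 * k.+1) * 2 ^ T.*2 * 2 ^ (m.+1 + 2 ^ b) <= _).
  by rewrite !leq_mul2r leq_mul2l le_n !orbT.
rewrite -!expnD -expnM leq_exp2l //.
have : (3 * k + 12) * L.+1 < m.+1 * b.-1 by apply: ltn_ceil; lia.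
rewrite /T /revealed_bound -/L; nia.
Qed.

(** The fuel exceeds the sum of any two keys. The exponent [k] of the failure probability enters
    only the analysis. *)
Definition chain_lca (M : probe_model)
    (scan : (nat -> bool) -> nat -> (option (seq nat) -> probing M) -> probing M)
    (q : nat -> probe M) (p : nat -> nat) : lca M :=
  @LCA M (fun n N => N * (label_bits n).+1) (fun n N s x =>
    let w := decode s in
    pad (p n) (q x) (query (color_bit w.1) (rank_key w.2)
      (scan (color_bit w.1)) (2 * (2 ^ label_bits n * N)) x)).

Lemma chain_lca_weak_2coloring M scan q p :
  (forall h n N (G : idgraph n N) v k,
     outcome (@oracle M n N G) (scan h (vid G v) k) =
     outcome (@oracle M n N G) (k (neighbor_view h G v))) ->
  lca_for_weak_2coloring (@chain_lca M scan q p).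
Proof.
move=> scanP n N G s v nbr_v.
have [|u vu ne] := @chain_coloringP n N G (color_bit (decode s).1)
  (rank_key (decode s).2) (@rank_key_inj _ _ _ _ _)
  (2 * (2 ^ label_bits n * N)) _ v nbr_v.
  move=> u; have := rank_key_lt G (decode s).2 u.
  by have := rank_key_lt G (decode s).2 (target G (rank_key (decode s).2) u); lia.
exists u => //; rewrite /lca_color /= !pad_outcome.
by rewrite !(query_outcome (rank_key (decode s).2) (scanP _ _ _ G)).
Qed.

Local Open Scope ring_scope.

Lemma prob_ge (R : realType) r (E : pred (r.-tuple bool)) n k : (0 < n)%N ->
  (#|[predC E]| * n ^ k <= 2 ^ r)%N -> 1 - n%:R ^- k <= prob R E.
Proof.
move=> n0 leE; rewrite /prob.
have cE : (#|E| + #|[predC E]| = 2 ^ r)%N by rewrite cardC card_tuple card_bool.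
have p2 : 0 < (2 : R) ^+ r by apply: exprn_gt0.
have pn : 0 < (n%:R : R) ^+ k by apply: exprn_gt0; rewrite ltr0n.
have -> : (#|E|%:R : R) = 2 ^+ r - #|[predC E]|%:R.
  by rewrite -[2 ^+ r]natrX -cE natrD addrK.
rewrite mulrBl divff ?gt_eqF // lerB // ler_pdivrMr // mulrC ler_pdivlMr //.
by rewrite -!natrX -natrM ler_nat.
Qed.

Lemma prob1 (R : realType) r (E : pred (r.-tuple bool)) n k : (0 < n)%N ->
  (forall s, E s) -> 1 - n%:R ^- k <= prob R E.
Proof.
move=> n0 allE; apply: prob_ge => //; rewrite eq_card0 // => s.
by rewrite !inE; apply/negbTE; rewrite negbK; exact: allE.
Qed.

Section EmptyGraph.
Variables (n N : nat) (le_nN : (n <= N)%N).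

Lemma empty_portsP (v : 'I_n) :
  perm_eq [::] (enum ((fun _ _ => false) v : pred 'I_n)).
Proof. by rewrite (eq_enum (B := pred0)) ?enum0. Qed.

Definition empty_graph : idgraph n N :=
  @IdGraph n N (fun _ _ => false) (fun _ _ => erefl) (fun _ => erefl)
    (@nat_of_ord n) (@ord_inj n) (fun v => leq_trans (ltn_ord v) le_nN)
    (fun _ => [::]) empty_portsP.

End EmptyGraph.

(** The scan bound [wd T] is required for good seeds only, because a weak scan may be long
    otherwise. *)
Lemma chain_lca_Theta (R : realType) M scan q (f : nat -> R) (wd : nat -> nat) :
  (forall n N b T m (G : idgraph n N) hf (rf : {ffun 'I_N -> b.-tuple bool}) v c,
     ~~ bad G T m (hf, rf) ->
     (nprobes (@oracle M n N G) (scan (color_bit hf) (vid G v) c) <=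
      wd T + nprobes (@oracle M n N G) (c (neighbor_view (color_bit hf) G v)))%N) ->
  (forall k, exists C : R, forall n, (16 <= n)%N -> 1 <= f n /\
     ((chain_bound k n).*2.+1 * wd (revealed_bound k n))%:R <= C * f n) ->
  uses_Theta_probes (@chain_lca M scan q (fun n => (Num.truncn (f n)).+1)) f.
Proof.
move=> scan_cost growth k; have [C bnd] := growth k.
have C0 : 0 <= C.
  have [f1 le_C] := bnd 16 isT; have := le_trans (ler0n _ _) le_C.
  by rewrite pmulr_lge0 //; apply: lt_le_trans f1.
(* The padding alone exceeds [f n] and is at most [f n + 1 <= 2 * f n]; the exploration adds at most
   [C * f n]. *)
exists 1, (2 + C), 16%N; split => [||n N n16 le_nN]; [lra | lra |].
have n0 : (0 < n)%N by apply: leq_trans n16.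
have [f1 le_C] := bnd n n16; split=> [G|].
  apply: prob_ge => //.
  set T := revealed_bound k n; set m := chain_bound k n.
  apply: leq_trans (_ : #|bad (b := label_bits n) G T m| * n ^ k <= _)%N; last first.
    by apply: card_bad; [|exact: revealed_boundP|exact: chain_boundP].
  rewrite leq_mul2r; apply/orP; right.
  apply: leq_trans (card_decode _); apply/subset_leq_card/subsetP => s.
  rewrite !inE; apply: contraR => good; apply/forallP => v.
  rewrite /lca_cost /= pad_nprobes.
  have le_q : (nprobes (@oracle M n N G)
      (query (color_bit (decode s).1) (rank_key (decode s).2)
         (scan (color_bit (decode s).1)) (2 * (2 ^ label_bits n * N)) (vid G v))
      <= m.*2.+1 * wd T)%N.
    have good' : ~~ bad G T m ((decode s).1, (decode s).2) by case: decode good.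
    apply: query_cost => [u c|nz Nb]; first exact: scan_cost good'.
    exact: good_chain good' _ nz Nb.
  apply: le_trans (_ : ((Num.truncn (f n)).+1 + m.*2.+1 * wd T)%:R <= _).
    by rewrite ler_nat; exact: leq_add.
  have f0 : 0 <= f n by apply: le_trans f1.
  rewrite natrD -natr1; have := truncn_le (f n); rewrite f0 => le_f.
  by have := le_C; rewrite -/T -/m; lra.
exists (empty_graph le_nN); apply: prob1 => // s.
apply/existsP; exists (Ordinal n0).
rewrite mul1r /lca_cost /= pad_nprobes; apply/ltW.
by apply: lt_le_trans (truncnS_gt _) _; rewrite ler_nat leq_addr.
Qed.

(** * Comparison of integer and natural logarithms *)

Section Logarithms.
Variables (R : realType) (n : nat).
Hypothesis n16 : (16 <= n)%N.
Local Notation x := (ln (n%:R : R)).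
Local Notation y := (ln (ln (n%:R : R))).
Local Notation L := (trunc_log 2 n).

(** Both bounds come from [ln (1 + t) <= t], at [t = 1] and [t = -1/2]. *)
Lemma ln2_bounds : 2^-1 <= ln (2 : R) <= 1.
Proof.
apply/andP; split; last by have := @le_ln1Dx R 1; apply; lra.
have := @le_ln1Dx R (- 2^-1) ltac:(lra).
have -> : 1 + - 2^-1 = 2^-1 :> R by lra.
by rewrite lnV ?posrE //; lra.
Qed.

Let n_gt0 : (0 < n)%N.
Proof. exact: leq_trans n16. Qed.

Lemma trunc_log_le_ln : L%:R <= 2 * x.
Proof.
have /andP[ln2 _] := ln2_bounds.
have : ln ((2 ^ L)%:R : R) <= x.
  by rewrite ler_ln ?posrE ?ltr0n ?expn_gt0 // ler_nat trunc_logP.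
rewrite natrX lnXn // -[X in X <= _]mulr_natr.
have := ler_wpM2r (ler0n R L) ln2; lra.
Qed.

Lemma ln_le_trunc_log : x <= L.+1%:R.
Proof.
have /andP[_ ln2] := ln2_bounds.
have : x <= ln ((2 ^ L.+1)%:R : R).
  by rewrite ler_ln ?posrE ?ltr0n ?expn_gt0 // ler_nat ltnW // trunc_log_ltn.
rewrite natrX lnXn // -[X in _ <= X]mulr_natr.
have := ler_wpM2r (ler0n R L.+1) ln2; lra.
Qed.

Lemma ln_ge2 : 2 <= x.
Proof.
have /andP[ln2 _] := ln2_bounds.
have : ln ((2 ^ 4)%:R : R) <= x by rewrite ler_ln ?posrE ?ltr0n // ler_nat.
by rewrite natrX lnXn // -[X in X <= _]mulr_natr; lra.
Qed.

Lemma lnln_gt0 : 0 < y.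
Proof. by apply: ln_gt0; apply: lt_le_trans ln_ge2; lra. Qed.

(** The factor 3 comes from [b + 1 <= 3 (b - 1)], valid since [b >= 2]. *)
Lemma lnln_le : y <= 3 * (label_bits n).-1%:R.
Proof.
have /andP[_ ln2] := ln2_bounds; have x2 := ln_ge2.
have b2 := label_bits_ge2 n16; set b := label_bits n in b2 *.
have : y <= ln ((2 ^ b.+1)%:R : R).
  rewrite ler_ln ?posrE ?ltr0n ?expn_gt0 //; last by lra.
  by apply: le_trans ln_le_trunc_log _; rewrite ler_nat trunc_log_ltn.
rewrite natrX lnXn // -[X in _ <= X]mulr_natr => le_y.
apply: le_trans (_ : b.+1%:R <= _).
  by have := ler_wpM2r (ler0n R b.+1) ln2; lra.
by rewrite -natrM ler_nat; lia.
Qed.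

Lemma ln_div_lnln_ge1 : 1 <= x / y.
Proof.
rewrite ler_pdivlMr ?lnln_gt0 // mul1r; apply/ltW/ln_sublinear.
by have := ln_ge2; lra.
Qed.

(** Combining [L + 1 <= 3 ln n] with [lnln_le] gives the factor 9, doubled by [2 m + 1]; the final 1
    is absorbed by [ln n / ln ln n >= 1]. *)
Lemma chain_bound_le k :
  (chain_bound k n).*2.+1%:R <= (18 * (3 * k + 12) + 1)%:R * (x / y).
Proof.
have y0 := lnln_gt0; have x2 := ln_ge2; have f1 := ln_div_lnln_ge1.
have m0 := ler0n R (chain_bound k n).
have le_m : (chain_bound k n)%:R * (label_bits n).-1%:R
    <= (3 * k + 12)%:R * L.+1%:R :> R.
  by rewrite -!natrM ler_nat leq_divM.
have le_y := lnln_le; have le_L := trunc_log_le_ln.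
have K0 := ler0n R (3 * k + 12).
have le_my : (chain_bound k n)%:R <= (9 * (3 * k + 12))%:R * (x / y).
  rewrite mulrA ler_pdivlMr //.
  have : (chain_bound k n)%:R * y <= 3 * ((3 * k + 12)%:R * L.+1%:R) by nra.
  rewrite natrM -natr1; nra.
rewrite -natr1 -mul2n natrM natrD.
have -> : (18 * (3 * k + 12))%:R = 2 * (9 * (3 * k + 12))%:R :> R.
  by rewrite -natrM; congr (_%:R); lia.
lra.
Qed.

Lemma revealed_bound_le k : (revealed_bound k n).+1%:R <= (3 * k + 7)%:R * x.
Proof.
have x2 := ln_ge2; have le_L := trunc_log_le_ln; have k0 := ler0n R k.
have -> : (revealed_bound k n).+1 = (k * L + k + L + 5)%N.
  by rewrite /revealed_bound; lia.
rewrite !natrD !natrM; have := ler_wpM2l k0 le_L; have := ler_wpM2l k0 x2.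
lra.
Qed.

End Logarithms.

Theorem theorem5 (R : realType) :
  (exists A : lca weak_model,
     lca_for_weak_2coloring A /\
     uses_Theta_probes A (fun n => (ln n%:R) ^+ 2 / ln (ln n%:R) : R)) /\
  (exists A : lca strong_model,
     lca_for_weak_2coloring A /\
     uses_Theta_probes A (fun n => ln n%:R / ln (ln n%:R) : R)).
Proof.
split.
  (* The dummy probe asks for the degree; the number of dummies is fixed later by unification with
     [chain_lca_Theta]. *)
  eexists (chain_lca weak_scan (fun x => (x, 0%N)) _); split.
    by apply: chain_lca_weak_2coloring => h n N G v k; exact: weak_scan_outcome.
  apply: (@chain_lca_Theta _ _ _ _ _ succn).
    move=> n N b T m G hf rf v c good; apply: weak_scan_cost.
    exact: good_ports good v.
  move=> k; exists ((18 * (3 * k + 12) + 1)%:R * (3 * k + 7)%:R) => n n16.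
  have f1 := ln_div_lnln_ge1 R n16; have x2 := ln_ge2 R n16.
  (* One factor bounds the cost of a scan, the other the number of scans. *)
  have -> : ln (n%:R : R) ^+ 2 / ln (ln n%:R) = ln n%:R * (ln n%:R / ln (ln n%:R)).
    by rewrite expr2 mulrA.
  split; first by nra.
  rewrite natrM mulrACA -mulrA [X in _ <= X]mulrCA.
  apply: le_trans (ler_pM (ler0n _ _) (ler0n _ _)
    (chain_bound_le R n16 k) (revealed_bound_le R n16 k)) _.
  by rewrite le_eqVlt; apply/orP; left; apply/eqP; ring.
eexists (chain_lca strong_scan id _); split.
  by apply: chain_lca_weak_2coloring => h n N G v k; exact: strong_scan_outcome.
apply: (@chain_lca_Theta _ _ _ _ _ (fun=> 1%N)).
  by move=> n N b T m G hf rf v c _; exact: strong_scan_cost.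
move=> k; exists (18 * (3 * k + 12) + 1)%:R => n n16.
by rewrite muln1; split; [exact: ln_div_lnln_ge1|exact: chain_bound_le].
Qed.
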